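(* The variety $\mathsf{RQEA}_\omega$ of representable quasi-polyadic equality algebras of dimension $\omega$ cannot be axiomatized over $\mathsf{RQA}_\omega$ by a set of universal formulas containing only finitely many variables; that is, there is no set $\Sigma$ of universal first-order formulas in the signature of $\mathsf{QEA}_\omega$, using altogether only finitely many variables and valid in $\mathsf{RQEA}_\omega$, such that every algebra $\mathfrak A$ of the $\mathsf{QEA}_\omega$ signature with $\mathfrak A\models\Sigma$ and whose quasi-polyadic (diagonal-free) reduct lies in $\mathsf{RQA}_\omega$ belongs to $\mathsf{RQEA}_\omega$.
   Context: The signature of $\mathsf{QEA}_\omega$ consists of the Boolean operations, cylindrifiers $\mathsf c_i$, diagonal constants $\mathsf d_{ij}$, and substitutions $\mathsf s_{[i/j]}$ (replacements) and $\mathsf s_{[i,j]}$ (transpositions) for $i,j<\omega$; the signature of $\mathsf{QA}_\omega$ is the same without the diagonal constants. $\mathsf{RQEA}_\omega$ and $\mathsf{RQA}_\omega$ are the classes of representable quasi-polyadic equality algebras, resp. representable quasi-polyadic algebras, of dimension $\omega$. In general, for varieties $\mathsf K$ of signature $t$ and $\mathsf L$ of signature $t'\subseteq t$, a set $\Sigma$ of formulas of signature $t$ axiomatizes $\mathsf K$ over $\mathsf L$ if for every $t$-algebra $\mathfrak A$, $\mathfrak A\models\Sigma$ and $\mathrm{Rd}_{t'}\mathfrak A\in\mathsf L$ imply $\mathfrak A\in\mathsf K$. *)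

(* Defs.v *)
From Stdlib Require Import Arith List.

Record QA_alg := {
  qa_car :> Type;
  qa_join : qa_car -> qa_car -> qa_car;
  qa_meet : qa_car -> qa_car -> qa_car;
  qa_compl : qa_car -> qa_car;
  qa_zero : qa_car;
  qa_one : qa_car;
  qa_cyl : nat -> qa_car -> qa_car;
  qa_subr : nat -> nat -> qa_car -> qa_car;
  qa_subt : nat -> nat -> qa_car -> qa_car
}.

Record QEA_alg := {
  qea_rd :> QA_alg;
  qea_diag : nat -> nat -> qa_car qea_rd
}.

Definition upd {U : Type} (s : nat -> U) (i : nat) (u : U) : nat -> U :=
  fun k => if Nat.eqb k i then u else s k.

Definition repl (i j : nat) : nat -> nat :=
  fun k => if Nat.eqb k i then j else k.

Definition transp (i j : nat) : nat -> nat :=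
  fun k => if Nat.eqb k i then j else if Nat.eqb k j then i else k.

Definition sset (U : Type) := (nat -> U) -> Prop.

Definition set_cyl {U} (i : nat) (X : sset U) : sset U :=
  fun s => exists u, X (upd s i u).
Definition set_diag {U} (i j : nat) : sset U := fun s => s i = s j.
Definition set_sub {U} (tau : nat -> nat) (X : sset U) : sset U :=
  fun s => X (fun k => s (tau k)).

Definition QA_embedding (A : QA_alg) (K : Type) (U : K -> Type)
  (h : qa_car A -> forall k, sset (U k)) : Prop :=
  (forall x y, (forall k s, h x k s <-> h y k s) -> x = y) /\
  (forall x y k s, h (qa_join A x y) k s <-> (h x k s \/ h y k s)) /\
  (forall x y k s, h (qa_meet A x y) k s <-> (h x k s /\ h y k s)) /\
  (forall x k s, h (qa_compl A x) k s <-> ~ h x k s) /\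
  (forall k s, h (qa_zero A) k s <-> False) /\
  (forall k s, h (qa_one A) k s <-> True) /\
  (forall i x k s, h (qa_cyl A i x) k s <-> set_cyl i (h x k) s) /\
  (forall i j x k s, h (qa_subr A i j x) k s <-> set_sub (repl i j) (h x k) s) /\
  (forall i j x k s, h (qa_subt A i j x) k s <-> set_sub (transp i j) (h x k) s).

(* RQA_omega = SP { full set QA_omega-algebras P(^omega U) } *)
Definition RQA (A : QA_alg) : Prop :=
  exists (K : Type) (U : K -> Type) (h : qa_car A -> forall k, sset (U k)),
    QA_embedding A K U h.

(* RQEA_omega = SP { full set QEA_omega-algebras P(^omega U) } *)
Definition RQEA (A : QEA_alg) : Prop :=
  exists (K : Type) (U : K -> Type) (h : qa_car A -> forall k, sset (U k)),
    QA_embedding A K U h /\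
    (forall i j k s, h (qea_diag A i j) k s <-> set_diag i j s).

Inductive term : Type :=
  | tVar : nat -> term
  | tJoin : term -> term -> term
  | tMeet : term -> term -> term
  | tCompl : term -> term
  | tZero : term
  | tOne : term
  | tCyl : nat -> term -> term
  | tDiag : nat -> nat -> term
  | tSubr : nat -> nat -> term -> term
  | tSubt : nat -> nat -> term -> term.

Inductive formula : Type :=
  | fFalse : formula
  | fEq : term -> term -> formula
  | fNot : formula -> formula
  | fAnd : formula -> formula -> formula
  | fOr : formula -> formula -> formula
  | fImp : formula -> formula -> formula
  | fAll : nat -> formula -> formula
  | fEx : nat -> formula -> formula.

Fixpoint qf (phi : formula) : Prop :=
  match phi with
  | fFalse | fEq _ _ => True
  | fNot p => qf p
  | fAnd p q | fOr p q | fImp p q => qf p /\ qf q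
  | fAll _ _ | fEx _ _ => False
  end.

Fixpoint universal (phi : formula) : Prop :=
  match phi with
  | fAll _ p => universal p
  | p => qf p
  end.

Fixpoint term_vars_lt (n : nat) (t : term) : Prop :=
  match t with
  | tVar v => v < n
  | tJoin a b | tMeet a b => term_vars_lt n a /\ term_vars_lt n b
  | tCompl a | tCyl _ a | tSubr _ _ a | tSubt _ _ a => term_vars_lt n a
  | tZero | tOne | tDiag _ _ => True
  end.

Fixpoint vars_lt (n : nat) (phi : formula) : Prop :=
  match phi with
  | fFalse => True
  | fEq a b => term_vars_lt n a /\ term_vars_lt n b
  | fNot p => vars_lt n p
  | fAnd p q | fOr p q | fImp p q => vars_lt n p /\ vars_lt n q
  | fAll v p | fEx v p => v < n /\ vars_lt n p
  end.

Fixpoint teval (A : QEA_alg) (e : nat -> qa_car A) (t : term) : qa_car A :=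
  match t with
  | tVar v => e v
  | tJoin a b => qa_join A (teval A e a) (teval A e b)
  | tMeet a b => qa_meet A (teval A e a) (teval A e b)
  | tCompl a => qa_compl A (teval A e a)
  | tZero => qa_zero A
  | tOne => qa_one A
  | tCyl i a => qa_cyl A i (teval A e a)
  | tDiag i j => qea_diag A i j
  | tSubr i j a => qa_subr A i j (teval A e a)
  | tSubt i j a => qa_subt A i j (teval A e a)
  end.

Definition env_upd {X : Type} (e : nat -> X) (v : nat) (x : X) : nat -> X :=
  fun k => if Nat.eqb k v then x else e k.

Fixpoint sat (A : QEA_alg) (e : nat -> qa_car A) (phi : formula) : Prop :=
  match phi with
  | fFalse => False
  | fEq a b => teval A e a = teval A e b
  | fNot p => ~ sat A e p
  | fAnd p q => sat A e p /\ sat A e q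
  | fOr p q => sat A e p \/ sat A e q
  | fImp p q => sat A e p -> sat A e q
  | fAll v p => forall x, sat A (env_upd e v x) p
  | fEx v p => exists x, sat A (env_upd e v x) p
  end.

Definition models (A : QEA_alg) (phi : formula) : Prop :=
  forall e : nat -> qa_car A, sat A e phi.

Definition models_set (A : QEA_alg) (Sigma : formula -> Prop) : Prop :=
  forall phi, Sigma phi -> models A phi.

(* Main.v *)
(** Splitting. A sequence is good when its entries have pairwise distinct types
and almost all of them are the base point of their own type; such a sequence uses
every type exactly once, so the type of one entry is determined by the others. The
true base has [#|H|] elements of each type. Replace [H] by a larger group [G], keep
the diagonals of [H] as fake diagonals through a map [h : G -> H], and colour good
sequences by the sum of their [G]-values. The sets invariant under colour-preserving
automorphisms form an algebra whose diagonal-free reduct is a set algebra.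

Moving one entry of a good sequence within its type realizes every colour, and good
sequences of the same colour are conjugate, also after permuting coordinates. Hence
[n] invariant sets separate at most [2 ^ n <= #|H|] classes of colours, and with the
colours merged the true base over [H] bisimulates the one over [G].

With genuine diagonals, the [#|G|] colours would give [#|G|] distinct entries at
coordinate 0, all completing the same remainder to a good sequence. A point that
names a pair of types can replace two entries, which frees a coordinate in which two
such completions are compared: they have the same type. But a type has only
[#|H| < #|G|] elements up to the diagonals. *)

From mathcomp Require Import all_boot all_fingroup all_algebra.
From mathcomp Require Import boolp.
Require Import Defs.

Set Implicit Arguments.
Unset Strict Implicit.
Unset Printing Implicit Defensive.

Import GRing.Theory.

(** * Finite-support injections and updates of sequences *)

Lemma injective_eventually_id_bij (f : nat -> nat) (N : nat) :
  injective f -> (forall j, N <= j -> f j = j) ->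
  exists g, cancel f g /\ cancel g f.
Proof.
move=> fI fid.
(* A value at or above [N] is already taken by itself, so [f] restricts to an injection of a finite
   segment. *)
have fN i : i < N -> f i < N.
  move=> iN; rewrite ltnNge; apply/negP => Nf.
  by move: (fI _ _ (fid _ Nf)) => e; rewrite e leqNgt iN in Nf.
have fS p : exists i, f i == p.
  case: (leqP N p) => [Np|pN]; first by exists p; rewrite fid.
  pose F (i : 'I_N) : 'I_N := Ordinal (fN i (ltn_ord i)).
  have FI : injective F by move=> i j /(congr1 val) /= /fI /val_inj.
  have [F' _ F'K] := injF_bij FI.
  by exists (F' (Ordinal pN)); have /(congr1 val) /= -> := F'K (Ordinal pN).
exists (fun p => xchoose (fS p)).
by split=> i; [apply: fI|]; apply/eqP; apply: xchooseP (fS _).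
Qed.

Lemma nat_eqbE (i j : nat) : Nat.eqb i j = (i == j).
Proof. by elim: i j => [|i IH] [|j] //=; rewrite IH. Qed.

Lemma updE (W : Type) (s : nat -> W) i u j :
  upd s i u j = if j == i then u else s j.
Proof. by rewrite /upd nat_eqbE. Qed.

Lemma upd_same (W : Type) (s : nat -> W) i : upd s i (s i) = s.
Proof. by apply: funext => j; rewrite updE; case: eqP => [->|]. Qed.

Lemma upd_upd (W : Type) (s : nat -> W) i u v : upd (upd s i u) i v = upd s i v.
Proof. by apply: funext => j; rewrite !updE; case: eqP. Qed.

Lemma sub_repl (W : Type) (s : nat -> W) i j :
  (fun k => s (repl i j k)) = upd s i (s j).
Proof. by apply: funext => k; rewrite /repl /upd; case: Nat.eqb. Qed.

Lemma transpE i j k :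
  transp i j k = if k == i then j else if k == j then i else k.
Proof. by rewrite /transp !nat_eqbE. Qed.

Lemma transpK i j : involutive (transp i j).
Proof.
move=> k; rewrite !transpE; have [->|ki] := eqVneq k i.
  by rewrite eqxx; case: eqVneq.
by have [->|kj] := eqVneq k j; rewrite ?eqxx // (negPf ki) (negPf kj).
Qed.

(** * Colours of sequences *)

(* [inl (a, x)] is the element [x] of type [a], and [inr (a, b)] is a name for
   the pair of types [(a, b)]. *)
Definition point (G : Type) : Type := (nat * G + nat * nat)%type.

Definition kind : Type := (nat + nat * nat)%type.

Definition kd (G : Type) (w : point G) : kind :=
  match w with inl (a, _) => inl a | inr z => inr z end.

Section Colours.
Variable G : zmodType.
Implicit Types (t : nat -> point G) (c : G).
Local Open Scope ring_scope.

Definition weight (w : point G) : G :=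
  match w with inl (_, x) => x | inr _ => 0 end.

Definition tail N t := forall j, (N <= j)%N -> t j = inl (j, 0).

Definition good t :=
  [/\ exists N, tail N t, forall i, exists a, kd (t i) = inl a
    & injective (fun i => kd (t i))].

(** Base points weigh 0, so every bound [N] of the tail gives the same total. *)
Definition color t c :=
  good t /\ exists2 N, tail N t & \sum_(j < N) weight (t j) = c.

Lemma tail_le N M t : (N <= M)%N -> tail N t -> tail M t.
Proof. by move=> NM tN j Mj; apply: tN; apply: leq_trans Mj. Qed.

Lemma sum_tail N M t : (N <= M)%N -> tail N t ->
  \sum_(j < M) weight (t j) = \sum_(j < N) weight (t j).
Proof.
move=> NM tN; rewrite -!(big_mkord xpredT (fun j => weight (t j))).
rewrite (big_cat_nat (leq0n N) NM) /= [X in _ + X]big_nat_cond [X in _ + X]big1 ?addr0 //.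
by move=> j /andP[/andP[Nj _] _]; rewrite tN.
Qed.

Lemma color_uniq t c c' : color t c -> color t c' -> c = c'.
Proof.
move=> [_ [N tN <-]] [_ [M tM <-]].
by rewrite -(sum_tail (leq_maxl N M) tN) -(sum_tail (leq_maxr N M) tM).
Qed.

Lemma color_ex t : good t -> exists c, color t c.
Proof.
move=> gt; have [[N tN] _ _] := gt.
by exists (\sum_(j < N) weight (t j)); split=> //; exists N.
Qed.

Lemma color_upd t i u c : good (upd t i u) ->
  exists2 u', kd u' = kd u & color (upd t i u') c.
Proof.
move=> [[N0 tN0] ty tI].
have {N0 tN0} [N iN tN] : exists2 N, (i < N)%N & tail N (upd t i u).
  exists (maxn N0 i.+1); first by rewrite leq_max leqnn orbT.
  exact: tail_le (leq_maxl _ _) tN0.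
have [a ua] : exists a, kd u = inl a by have := ty i; rewrite updE eqxx.
pose o := Ordinal iN.
(* Keeps the type and takes the value that the other weights leave for the total [c]. *)
pose u' : point G := inl (a, c - \sum_(j < N | j != o) weight (t j)).
have tN' : tail N (upd t i u').
  move=> j Nj; have := tN j Nj; rewrite !updE.
  by case: eqP Nj => // ->; rewrite leqNgt iN.
have kE j : kd (upd t i u' j) = kd (upd t i u j).
  by rewrite !updE; case: eqP => // _; rewrite ua.
exists u'; first by rewrite ua.
split; first split.
- by exists N.
- by move=> j; rewrite kE; apply: ty.
- by move=> j l; rewrite !kE => /tI.
exists N => //; rewrite (bigD1 o) //= updE eqxx /=.
rewrite [X in _ + X](eq_bigr (fun j : 'I_N => weight (t j))) ?subrK //.
by move=> j jo; rewrite updE -[i]/(val o) val_eqE (negPf jo).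
Qed.

Lemma color_transp t c i j : color t c -> color (fun k => t (transp i j k)) c.
Proof.
move=> [[_ ty tI] [N0 tN0 <-]].
pose N := maxn N0 (maxn i.+1 j.+1).
have iN : (i < N)%N by rewrite !leq_max leqnn orbT.
have jN : (j < N)%N by rewrite !leq_max leqnn !orbT.
rewrite -(sum_tail (leq_maxl _ _ : (N0 <= N)%N) tN0).
have tN : tail N (fun k => t (transp i j k)).
  move=> k Nk; rewrite transpE.
  have [ki|_] := eqVneq k i; first by rewrite ki leqNgt iN in Nk.
  have [kj|_] := eqVneq k j; first by rewrite kj leqNgt jN in Nk.
  by apply: tN0; apply: leq_trans Nk; apply: leq_maxl.
split; first split.
- by exists N.
- by move=> k; apply: ty.
- by move=> k l /tI /(can_inj (@transpK i j)).
exists N => //; pose s := tperm (Ordinal iN) (Ordinal jN).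
rewrite [RHS](reindex_inj (@perm_inj _ s)) /=; apply: eq_bigr => k _.
congr (weight (t _)); rewrite transpE /s permE /= -!val_eqE /=.
by do 2?case: ifP.
Qed.

(** Otherwise positions [i] and [j] carry the same entry, against distinctness of types. *)
Lemma good_repl t i j : good (fun k => t (repl i j k)) -> i = j.
Proof.
move=> [_ _ tI]; apply: tI; rewrite /repl !nat_eqbE eqxx.
by case: eqP.
Qed.

Definition typ t i : nat := match kd (t i) with inl a => a | inr _ => 0%N end.

Lemma good_typE t i : good t -> kd (t i) = inl (typ t i).
Proof. by case=> _ /(_ i)[a e] _; rewrite /typ e. Qed.

Lemma good_typ_bij t : good t ->
  exists g, cancel (typ t) g /\ cancel g (typ t).
Proof.
move=> gt; have [[N tN] _ tI] := gt.
apply: (@injective_eventually_id_bij _ N); last by move=> j Nj; rewrite /typ tN.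
by move=> i j e; apply: tI; rewrite !good_typE ?e.
Qed.

Lemma good_surj t p : good t -> exists i, kd (t i) = inl p.
Proof.
move=> gt; have [g [_ gK]] := good_typ_bij gt.
by exists (g p); rewrite good_typE // gK.
Qed.

Definition base_seq : nat -> point G := fun j => inl (j, 0).

Lemma good_base : good base_seq.
Proof.
split; first by exists 0%N.
- by move=> i; exists i.
- by move=> i j [].
Qed.

End Colours.

(** * The bisimulation *)

Section Action.
Variable H : finZmodType.
Local Open Scope ring_scope.

Definition collapse (G : Type) (h : G -> H) (w : point G) : point H :=
  match w with inl (a, x) => inl (a, h x) | inr z => inr z end.

Definition kact (r : nat -> nat) (k : kind) : kind :=
  match k with inl a => inl (r a) | inr (a, b) => inr (r a, r b) end.

Definition act (r : nat -> nat) (th : nat -> {perm H}) (u : point H) : point H :=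
  match u with inl (a, x) => inl (r a, th a x) | inr (a, b) => inr (r a, r b) end.

(** Finite support keeps the tail of base points in place, so that goodness is invariant. *)
Definition adm (r r' : nat -> nat) (th : nat -> {perm H}) :=
  [/\ cancel r r', cancel r' r
    & exists N, forall a, (N <= a)%N -> r a = a /\ th a = 1%g].

(** Base points stay recognizable after collapsing, and every collapsed point can be lifted. *)
Definition faithful_at0 (G : zmodType) (h : G -> H) :=
  (forall x, h x = 0 <-> x = 0) /\ (forall y, exists x, h x = y).

Lemma kd_collapse G (h : G -> H) w : kd (collapse h w) = kd w.
Proof. by case: w => [[]|[]]. Qed.

Lemma kd_act r th u : kd (act r th u) = kact r (kd u).
Proof. by case: u => [[]|[]]. Qed.

Lemma kact_inj r : injective r -> injective (kact r).
Proof. by move=> rI [a|[a b]] [c|[c d]] //= [] => [/rI->|/rI-> /rI->]. Qed.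

Lemma act_inj r r' th : cancel r r' -> injective (act r th).
Proof.
move=> /can_inj rI [[a x]|[a b]] [[c y]|[c d]] //= [] => [/rI-> /perm_inj->|] //.
by move=> /rI-> /rI->.
Qed.

Lemma collapse_surj (G : zmodType) (h : G -> H) u :
  faithful_at0 h -> exists w, collapse h w = u.
Proof.
move=> [_ hS]; case: u => [[a y]|z]; last by exists (inr z).
by have [x <-] := hS y; exists (inl (a, x)).
Qed.

Section Weak.
Variables (G1 G2 : zmodType) (h1 : G1 -> H) (h2 : G2 -> H).

Definition weak (s : nat -> point G1) (t : nat -> point G2) :=
  exists r r' th, adm r r' th /\
    forall i, collapse h1 (s i) = act r th (collapse h2 (t i)).

Lemma weak_kd s t : weak s t ->
  exists2 r, injective r & forall i, kd (s i) = kact r (kd (t i)).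
Proof.
move=> [r [r' [th [[rK _ _] st]]]]; exists r; first exact: can_inj rK.
by move=> i; rewrite -(kd_collapse h1) st kd_act kd_collapse.
Qed.

Lemma weak_good s t : faithful_at0 h1 -> faithful_at0 h2 ->
  weak s t -> good t -> good s.
Proof.
move=> [h10 _] [h20 _] st [[N tN] ty tI].
have [r rI kE] := weak_kd st.
case: st => r1 [r' [th [[rK _ [M rM]] st]]]; split.
- exists (maxn N M) => j; rewrite geq_max => /andP[Nj Mj].
  have := st j; rewrite (tN j Nj) /=; have [-> ->] := rM j Mj.
  rewrite perm1; have /h20 -> := erefl (0 : G2).
  by case: (s j) => [[a x]|z] //= [-> /h10 ->].
- by move=> i; rewrite kE; have [a ->] := ty i; exists (r a).
- move=> i j; rewrite !kE => e; apply: tI; move: e.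
  have [a ->] := ty i; have [b ->] := ty j.
  by move=> /= [/rI ->].
Qed.

(* Any two good sequences lie in one orbit: match the types position by position
   and swap the two collapsed values sitting at each position. *)
Lemma good_weak s t : faithful_at0 h1 -> faithful_at0 h2 ->
  good s -> good t -> weak s t.
Proof.
move=> [h10 _] [h20 _] gs gt.
have [g [tK gK]] := good_typ_bij gt; have [g' [sK g'K]] := good_typ_bij gs.
exists (fun a => typ s (g a)), (fun a => typ t (g' a)).
exists (fun a => tperm (h2 (weight (t (g a)))) (h1 (weight (s (g a))))).
split; first split.
- by move=> a; rewrite sK gK.
- by move=> a; rewrite tK g'K.
- have [[N sN] _ _] := gs; have [[M tM] _ _] := gt.
  exists (maxn N M) => a; rewrite geq_max => /andP[Na Ma].
  have -> : g a = a by rewrite -[RHS]tK /typ tM.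
  rewrite /typ sN // tM //=; split=> //.
  have /h10 -> := erefl (0 : G1); have /h20 -> := erefl (0 : G2).
  exact: tperm1.
- move=> i; have := good_typE i gs; have := good_typE i gt.
  case et : (t i) => [[a x]|//] [ea]; case es : (s i) => [[b y]|//] [eb] /=.
  by rewrite ea tK et es /= tpermL eb.
Qed.

End Weak.

Lemma weak_refl (G : zmodType) (h : G -> H) t : weak h h t t.
Proof.
exists id, id, (fun=> 1%g); split; first by split=> //; exists 0%N.
by move=> i; case: (t i) => [[a x]|[]] //=; rewrite perm1.
Qed.

Lemma weak_sym (G1 G2 : zmodType) (h1 : G1 -> H) (h2 : G2 -> H) s t :
  weak h1 h2 s t -> weak h2 h1 t s.
Proof.
move=> [r [r' [th [[rK r'K [N rN]] st]]]].
exists r', r, (fun a => (th (r' a))^-1%g); split; first split=> //.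
  exists N => a Na; have [ra tha] := rN a Na.
  have -> : r' a = a by rewrite -{1}ra rK.
  by rewrite tha invg1.
move=> i; rewrite st; case: (collapse h2 _) => [[a x]|[a b]] /=; last by rewrite !rK.
by rewrite !rK permK.
Qed.

Lemma weak_trans (G1 G2 G3 : zmodType) (h1 : G1 -> H) (h2 : G2 -> H)
    (h3 : G3 -> H) s t u :
  weak h1 h2 s t -> weak h2 h3 t u -> weak h1 h3 s u.
Proof.
move=> [r [r' [th [[rK r'K [N rN]] st]]]] [q [q' [ph [[qK q'K [M qM]] tu]]]].
exists (r \o q), (q' \o r'), (fun a => ph a * th (q a))%g; split; first split.
- exact: can_comp.
- exact: can_comp.
- exists (maxn N M) => a; rewrite geq_max => /andP[Na Ma] /=.
  have [-> ->] := qM a Ma; have [-> ->] := rN a Na.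
  by rewrite mul1g.
- move=> i; rewrite st tu; case: (collapse h3 _) => [[a x]|[]] //=.
  by rewrite permM.
Qed.

Section Rel.
Variables (G1 G2 : zmodType) (h1 : G1 -> H) (h2 : G2 -> H).
Variables (L : Type) (g1 : G1 -> L) (g2 : G2 -> L).

(** Labels in [L] allow colours to be merged and to be compared across two groups; sequences that
    are not good have no colour to compare. *)
Definition rel s t :=
  weak h1 h2 s t /\ forall c1 c2, color s c1 -> color t c2 -> g1 c1 = g2 c2.

Hypotheses (h1P : faithful_at0 h1) (h2P : faithful_at0 h2).
Hypothesis g12 : forall c2, exists c1, g1 c1 = g2 c2.

Lemma rel_transp s t i j : rel s t ->
  rel (fun k => s (transp i j k)) (fun k => t (transp i j k)).
Proof.
move=> [[r [r' [th [a st]]]] cst]; split.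
  by exists r, r', th; split=> // k; apply: st.
move=> c1 c2 /(color_transp i j) /= cs /(color_transp i j) /= ct; apply: cst.
- rewrite (_ : s = fun k => s (transp i j (transp i j k))) //.
  by apply: funext => k; rewrite transpK.
- rewrite (_ : t = fun k => t (transp i j (transp i j k))) //.
  by apply: funext => k; rewrite transpK.
Qed.

(** A proper replacement repeats an entry, so no colour is left to compare; for [i = j] nothing
    changes. *)
Lemma rel_repl s t i j : rel s t ->
  rel (fun k => s (repl i j k)) (fun k => t (repl i j k)).
Proof.
move=> [[r [r' [th [a st]]]] cst]; split.
  by exists r, r', th; split=> // k; apply: st.
move=> c1 c2 cs ct; have ij := good_repl cs.1.
by move: cs ct; rewrite ij !sub_repl !upd_same => cs ct; apply: cst.
Qed.

(* A new good sequence has pairwise distinct types, so the value at the changed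
   position can be moved within its type to adjust the colour: the automorphism
   is corrected on that type only, which no other position sees. *)
Lemma rel_forth s t i u : weak h1 h2 s t ->
  exists u', rel (upd s i u') (upd t i u).
Proof.
move=> st0; have [r [r' [th [[rK r'K [N rN]] st]]]] := st0.
have [u0 u0E] := collapse_surj (act r th (collapse h2 u)) h1P.
have st1 : weak h1 h2 (upd s i u0) (upd t i u).
  exists r, r', th; split; first by split=> //; exists N.
  by move=> j; rewrite !updE; case: eqP.
have [gt|ngt] := pselect (good (upd t i u)); last first.
  by exists u0; split=> // c1 c2 _ [].
have gs := weak_good h1P h2P st1 gt.
have [c2 tc2] := color_ex gt; have [c1 c12] := g12 c2.
have [u' ku' sc1] := color_upd c1 gs.
exists u'; split; last first.
  by move=> d1 d2 /(color_uniq sc1) <- /(color_uniq tc2) <-.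
have [_ ty tI] := gt.
have [a ua] : exists a, kd u = inl a by have := ty i; rewrite updE eqxx.
case: u {st1} u0E gt ty tI ua ku' tc2 => [[b x]|//] u0E gt ty tI [eb] ku' tc2; subst b.
have ku0 : kd u0 = inl (r a) by rewrite -(kd_collapse h1) u0E.
case: u' ku' sc1 => [[b' x']|z] ku' sc1; move: (ku'); rewrite ku0 => // -[b'E]; subst b'.
exists r, r', (fun b => if b == a then th a * tperm (th a (h2 x)) (h1 x') else th b)%g.
split; first split=> //.
  exists (maxn N a.+1) => d; rewrite geq_max => /andP[Nd ad].
  by rewrite gtn_eqF //; apply: rN.
move=> j; rewrite !updE; have [ji|ji] := eqVneq j i.
  by rewrite /= eqxx permM tpermL.
rewrite st; case e : (t j) => [[d y]|[]] //=.
case: eqP => // da; case/eqP: ji; apply: tI.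
by rewrite !updE eqxx; case: eqP => //= _; rewrite e da.
Qed.

(** Lifting entrywise gives a conjugate; choosing the entry at 0 anew by [rel_forth] corrects the
    colour. *)
Lemma rel_total t : exists s, rel s t.
Proof.
have [w wE] := choice (fun u => @collapse_surj _ h1 u h1P).
have : weak h1 h2 (fun i => w (collapse h2 (t i))) t.
  exists id, id, (fun=> 1%g); split; first by split=> //; exists 0%N.
  by move=> i; rewrite wE; case: (collapse h2 _) => [[a x]|[]] //=; rewrite perm1.
by move=> /(rel_forth 0%N (t 0%N))[u]; rewrite upd_same => st; eexists; exact: st.
Qed.

Lemma rel_diag s t i j : rel s t ->
  (collapse h1 (s i) = collapse h1 (s j)) <->
  (collapse h2 (t i) = collapse h2 (t j)).
Proof.
move=> [[r [r' [th [[rK _ _] st]]]] _]; rewrite !st.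
by split=> [/(act_inj rK)|->].
Qed.

End Rel.

Lemma rel_sym (G1 G2 : zmodType) (h1 : G1 -> H) (h2 : G2 -> H)
    (L : Type) (g1 : G1 -> L) (g2 : G2 -> L) s t :
  rel h1 h2 g1 g2 s t -> rel h2 h1 g2 g1 t s.
Proof. by move=> [/weak_sym st cst]; split=> // c1 c2 ct cs; rewrite (cst _ _ cs ct). Qed.

End Action.

(** * The algebra of a bisimulation *)

Section PairAlgebra.
Variables (W1 W2 : Type) (D1 : W1 -> W1 -> Prop) (D2 : W2 -> W2 -> Prop).
Variable r : (nat -> W1) -> (nat -> W2) -> Prop.

Record bisim : Prop := {
  bisim_left : forall s, exists t, r s t;
  bisim_right : forall t, exists s, r s t;
  bisim_back : forall s t i u, r s t -> exists u', r (upd s i u) (upd t i u');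
  bisim_forth : forall s t i u, r s t -> exists u', r (upd s i u') (upd t i u);
  bisim_repl : forall s t i j, r s t ->
    r (fun k => s (repl i j k)) (fun k => t (repl i j k));
  bisim_transp : forall s t i j, r s t ->
    r (fun k => s (transp i j k)) (fun k => t (transp i j k));
  bisim_diag : forall s t i j, r s t -> D1 (s i) (s j) <-> D2 (t i) (t j)
}.

(** Along a bisimulation each component determines the other, so one algebra of such pairs lives
    over both bases. *)
Definition matched (p : sset W1 * sset W2) :=
  forall s t, r s t -> (p.1 s <-> p.2 t).

Hypothesis b : bisim.

Local Notation car := {p | matched p}.

Lemma matched_join (x y : car) :
  matched (fun s => (sval x).1 s \/ (sval y).1 s,
           fun t => (sval x).2 t \/ (sval y).2 t).
Proof. by move=> s t st /=; rewrite (svalP x _ _ st) (svalP y _ _ st). Qed.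

Lemma matched_meet (x y : car) :
  matched (fun s => (sval x).1 s /\ (sval y).1 s,
           fun t => (sval x).2 t /\ (sval y).2 t).
Proof. by move=> s t st /=; rewrite (svalP x _ _ st) (svalP y _ _ st). Qed.

Lemma matched_compl (x : car) :
  matched (fun s => ~ (sval x).1 s, fun t => ~ (sval x).2 t).
Proof. by move=> s t st /=; rewrite (svalP x _ _ st). Qed.

Lemma matched_const (P : Prop) : matched (fun=> P, fun=> P).
Proof. by []. Qed.

Lemma matched_cyl i (x : car) :
  matched (set_cyl i (sval x).1, set_cyl i (sval x).2).
Proof.
move=> s t st /=; split=> -[u xu].
- by have [u' st'] := bisim_back b i u st; exists u'; apply/(svalP x _ _ st').
- by have [u' st'] := bisim_forth b i u st; exists u'; apply/(svalP x _ _ st').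
Qed.

Lemma matched_repl i j (x : car) :
  matched (set_sub (repl i j) (sval x).1, set_sub (repl i j) (sval x).2).
Proof. by move=> s t /(bisim_repl b i j)/(svalP x). Qed.

Lemma matched_transp i j (x : car) :
  matched (set_sub (transp i j) (sval x).1, set_sub (transp i j) (sval x).2).
Proof. by move=> s t /(bisim_transp b i j)/(svalP x). Qed.

Lemma matched_diag i j :
  matched (fun s => D1 (s i) (s j), fun t => D2 (t i) (t j)).
Proof. by move=> s t /(bisim_diag b i j). Qed.

Definition pair_alg : QEA_alg := {|
  qea_rd := {|
    qa_car := car;
    qa_join := fun x y => exist _ _ (matched_join x y);
    qa_meet := fun x y => exist _ _ (matched_meet x y);
    qa_compl := fun x => exist _ _ (matched_compl x);
    qa_zero := exist _ _ (matched_const False);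
    qa_one := exist _ _ (matched_const True);
    qa_cyl := fun i x => exist _ _ (matched_cyl i x);
    qa_subr := fun i j x => exist _ _ (matched_repl i j x);
    qa_subt := fun i j x => exist _ _ (matched_transp i j x) |};
  qea_diag := fun i j => exist _ _ (matched_diag i j) |}.

Lemma pair_alg_ext2 (x y : pair_alg) :
  (forall t, (sval x).2 t <-> (sval y).2 t) -> x = y.
Proof.
case: x y => -[X1 X2] xP [[Y1 Y2] yP] /= xy; apply: eq_exist.
congr pair; apply: funext => s; apply: propext; last exact: xy.
have [t st] := bisim_left b s; have /= xE := xP _ _ st; have /= yE := yP _ _ st.
by rewrite xE yE.
Qed.

Lemma pair_alg_ext1 (x y : pair_alg) :
  (forall s, (sval x).1 s <-> (sval y).1 s) -> x = y.
Proof.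
move=> xy; apply: pair_alg_ext2 => t; have [s st] := bisim_right b t.
by rewrite -(svalP x _ _ st) -(svalP y _ _ st).
Qed.

(** The second projection is faithful; only the diagonals, read there as [D2], may fail to be
    genuine. *)
Lemma pair_alg_RQA : RQA pair_alg.
Proof.
exists unit, (fun=> W2), (fun x _ => (sval x).2).
split; first by move=> x y xy; apply: pair_alg_ext2 => t; apply: (xy tt).
by do 7?[split; first by move=> *; apply: iff_refl]; move=> *; apply: iff_refl.
Qed.

Lemma pair_alg_RQEA : (forall u v, D1 u v <-> u = v) -> RQEA pair_alg.
Proof.
move=> DE; exists unit, (fun=> W1), (fun x _ => (sval x).1).
split; last by move=> i j k s; apply: DE.
split; first by move=> x y xy; apply: pair_alg_ext1 => s; apply: (xy tt).
by do 7?[split; first by move=> *; apply: iff_refl]; move=> *; apply: iff_refl.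
Qed.

End PairAlgebra.

(** * Universal formulas in few variables *)

Fixpoint matrix (phi : formula) : formula :=
  match phi with fAll _ p => matrix p | p => p end.

Lemma qf_matrix phi : universal phi -> qf (matrix phi).
Proof. by elim: phi. Qed.

Lemma vars_lt_matrix n phi : vars_lt n phi -> vars_lt n (matrix phi).
Proof. by elim: phi => //= v p IH [_ /IH]. Qed.

(** Validity already ranges over all assignments, so it absorbs the universal prefix. *)
Lemma models_matrix A phi : models A phi <-> models A (matrix phi).
Proof.
elim: phi => //= v p IH; rewrite -IH; split=> pA e; last by move=> x; apply: pA.
have := pA e (e v); congr (sat A _ p); apply: funext => k.
by rewrite /env_upd nat_eqbE; case: eqP => [->|].
Qed.

Section Transfer.
Variables (W W1 W2 : Type) (D : W -> W -> Prop).
Variables (D1 : W1 -> W1 -> Prop) (D2 : W2 -> W2 -> Prop).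
Variables (r1 : (nat -> W1) -> (nat -> W) -> Prop) (b1 : bisim D1 D r1).
Variables (r2 : (nat -> W2) -> (nat -> W) -> Prop) (b2 : bisim D2 D r2).
Variables (n : nat) (e1 : nat -> pair_alg b1) (e2 : nat -> pair_alg b2).
Hypothesis e12 : forall j, j < n -> (sval (e1 j)).2 = (sval (e2 j)).2.

(** Both algebras compute second components by the same operations over [W], with the same [D]. *)
Lemma teval_transfer t : term_vars_lt n t ->
  (sval (teval (pair_alg b1) e1 t)).2 = (sval (teval (pair_alg b2) e2 t)).2.
Proof.
elim: t => //=.
- by move=> v /ltP /e12.
- by move=> t IHt u IHu [/IHt -> /IHu ->].
- by move=> t IHt u IHu [/IHt -> /IHu ->].
- by move=> t IHt /IHt ->.
- by move=> i t IHt /IHt ->.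
- by move=> i j t IHt /IHt ->.
- by move=> i j t IHt /IHt ->.
Qed.

Lemma sat_transfer phi : qf phi -> vars_lt n phi ->
  sat (pair_alg b1) e1 phi <-> sat (pair_alg b2) e2 phi.
Proof.
elim: phi => //=.
- move=> t u _ [/teval_transfer te /teval_transfer ue].
  by split=> E; apply: pair_alg_ext2; [rewrite -te -ue | rewrite te ue]; rewrite E.
- by move=> p IH qp vp; rewrite IH.
- by move=> p IHp q IHq [qp qq] [vp vq]; rewrite IHp // IHq.
- by move=> p IHp q IHq [qp qq] [vp vq]; rewrite IHp // IHq.
- by move=> p IHp q IHq [qp qq] [vp vq]; rewrite IHp // IHq.
Qed.

End Transfer.

(** * The algebra of all invariant sets *)

Lemma bisim_rel (H : finZmodType) (G1 G2 : zmodType) (h1 : G1 -> H) (h2 : G2 -> H)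
    (L : Type) (g1 : G1 -> L) (g2 : G2 -> L) :
  faithful_at0 h1 -> faithful_at0 h2 ->
  (forall c1, exists c2, g2 c2 = g1 c1) -> (forall c2, exists c1, g1 c1 = g2 c2) ->
  bisim (fun u v => collapse h1 u = collapse h1 v)
        (fun u v => collapse h2 u = collapse h2 v) (rel h1 h2 g1 g2).
Proof.
move=> h1P h2P g12 g21; split.
- by move=> s; have [t /rel_sym] := rel_total h2P h1P g12 s; exists t.
- by move=> t; apply: rel_total.
- move=> s t i u [/weak_sym ts _].
  by have [u' /rel_sym] := rel_forth h2P h1P g12 i u ts; exists u'.
- by move=> s t i u [st _]; apply: rel_forth.
- by move=> s t i j; apply: rel_repl.
- by move=> s t i j; apply: rel_transp.
- by move=> s t i j; apply: rel_diag.
Qed.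

Lemma collapse_id (H : finZmodType) (u : point H) : collapse id u = u.
Proof. by case: u => [[]|]. Qed.

Lemma faithful_id (H : finZmodType) : faithful_at0 (@id H).
Proof. by split=> // y; exists y. Qed.

Lemma label_surj (T S : finType) (L : finType) (g : T -> L) (x0 : T) :
  #|L| <= #|S| ->
  exists f : S -> L, (forall x, exists y, g y = f x) /\ (forall y, exists x, f x = g y).
Proof.
move=> LS; pose l := undup (codom g).
(* [l] lists the labels in use; surplus elements of [S] get the default [g x0], itself in use. *)
exists (fun x => nth (g x0) l (enum_rank x)); split=> [x|y].
- case: (ltnP (enum_rank x) (size l)) => [xl|lx]; last by exists x0; rewrite nth_default.
  have := mem_nth (g x0) xl; rewrite mem_undup => /codomP[y ->].
  by exists y.
- have gl : g y \in l by rewrite mem_undup codom_f.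
  have iS : index (g y) l < #|S|.
    apply: leq_trans LS; apply: (@leq_trans (size l)); first by rewrite index_mem.
    by rewrite -(card_uniqP (undup_uniq _)) max_card.
  by exists (enum_val (Ordinal iS)); rewrite enum_valK nth_index.
Qed.

Section Invariant.
Variables (G H : finZmodType) (h : G -> H).
Hypothesis hP : faithful_at0 h.

Definition eqv := rel h h (@id G) id.

Lemma bisim_eqv :
  bisim (fun u v => collapse h u = collapse h v)
        (fun u v => collapse h u = collapse h v) eqv.
Proof. by apply: bisim_rel => // c; exists c. Qed.

Definition inv_alg : QEA_alg := pair_alg bisim_eqv.

Lemma eqv_refl t : eqv t t.
Proof. by split; [exact: weak_refl | move=> c d; apply: color_uniq]. Qed.

Lemma eqv_sym s t : eqv s t -> eqv t s. Proof. exact: rel_sym. Qed.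

Lemma inv_alg_invariant (x : inv_alg) s t :
  eqv s t -> (sval x).2 s -> (sval x).2 t.
Proof.
(* [eqv] is reflexive, so the two components of [x] coincide. *)
move=> st xs; apply/(svalP x _ _ st); apply/(svalP x _ _ (eqv_refl s)).
exact: xs.
Qed.

(* On good sequences an invariant set only sees the colour, so [n] of them
   distinguish at most [2 ^ n] classes of colours. *)
Lemma inv_alg_local n (e : nat -> inv_alg) : 2 ^ n <= #|H| ->
  exists (r : (nat -> point H) -> (nat -> point G) -> Prop)
    (b : bisim (fun u v => collapse id u = collapse id v)
               (fun u v => collapse h u = collapse h v) r)
    (e' : nat -> pair_alg b),
    forall j, j < n -> (sval (e' j)).2 = (sval (e j)).2.
Proof.
move=> nH.
(* [g c] records which of the [n] sets meet the colour [c]. *)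
pose g c : {ffun 'I_n -> bool} :=
  [ffun j : 'I_n => `[< exists2 t, color t c & (sval (e j)).2 t >]].
have [f [gf fg]] : exists f : H -> {ffun 'I_n -> bool},
    (forall x, exists y, g y = f x) /\ (forall y, exists x, f x = g y).
  by apply: label_surj (0 : G)%R _; rewrite card_ffun card_bool card_ord.
pose r := rel id h f g.
have b := bisim_rel (@faithful_id H) hP gf fg.
(* The first component is forced: it is the preimage of the given set under [r]. *)
pose Y j s := exists2 t, r s t & (sval (e j)).2 t.
have eP j : j < n -> matched r (Y j, (sval (e j)).2).
  move=> jn s t st /=; split; last by move=> et; exists t.
  move=> [t' st' et'].
  have tt' : weak h h t' t by apply: weak_trans (weak_sym st'.1) st.1.
  have [gt'|ngt'] := pselect (good t'); last first.
    apply: inv_alg_invariant et'; split=> // c1 c2 [/ngt'] //.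
  have gs := weak_good (@faithful_id H) hP st'.1 gt'.
  have gt := weak_good hP hP (weak_sym tt') gt'.
  have [c ct] := color_ex gt; have [c' ct'] := color_ex gt'.
  have [x sx] := color_ex gs.
  (* Equal labels: the set meets the colour of [t'], hence that of [t], and by invariance contains
     [t]. *)
  have /ffunP/(_ (Ordinal jn)) : g c' = g c.
    by rewrite -(st'.2 _ _ sx ct') -(st.2 _ _ sx ct).
  rewrite !ffunE /= => E.
  have /asboolP : `[< exists2 t, color t c & (sval (e j)).2 t >].
    by rewrite -E; apply/asboolP; exists t'.
  move=> [t2 ct2 et2]; apply: inv_alg_invariant et2; split.
    by apply: good_weak => //; case: ct2.
  by move=> d1 d2 /(color_uniq ct2) <- /(color_uniq ct) <-.
have /choice[e' e'E] : forall j, exists x : pair_alg b,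
    j < n -> (sval x).2 = (sval (e j)).2.
  move=> j.
  have [jn|nj] := boolP (j < n); last by exists (qa_zero (pair_alg b)).
  by exists (exist _ _ (eP j jn)).
by exists r, b, e'.
Qed.

(** Any assignment is mimicked on [n] variables in a pair algebra whose first base has genuine
    diagonals. *)
Lemma inv_alg_models n phi : 2 ^ n <= #|H| -> universal phi -> vars_lt n phi ->
  (forall A, RQEA A -> models A phi) -> models inv_alg phi.
Proof.
move=> nH uphi vphi valid; apply/models_matrix => e.
have [r [b [e' ee']]] := inv_alg_local e nH.
apply/(sat_transfer ee' (qf_matrix uphi) (vars_lt_matrix vphi)).
have bR : RQEA (pair_alg b) by apply: pair_alg_RQEA => u v; rewrite !collapse_id.
by have /models_matrix := valid _ bR; apply.
Qed.

End Invariant.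

(** * Non-representability *)

Section NonRepresentable.
Variables (m : nat) (H : finZmodType) (h : 'I_m.+1 -> H).
Hypothesis hP : faithful_at0 h.
Hypothesis mH : #|H| < m.+1.

Local Notation A := (inv_alg hP).
Implicit Types (t : nat -> point 'I_m.+1) (x y : A).

Lemma invariant_matched (X : sset (point 'I_m.+1)) :
  (forall s t, eqv h s t -> X s -> X t) -> matched (eqv h) (X, X).
Proof.
by move=> XI s t st; split; apply: XI => //; apply: eqv_sym.
Qed.

Definition elt X (XI : forall s t, eqv h s t -> X s -> X t) : A :=
  exist _ (X, X) (invariant_matched XI).

Definition same_type i j t := exists a, kd (t i) = inl a /\ kd (t j) = inl a.

Definition named i j l t :=
  exists a b, [/\ kd (t i) = inr (a, b), kd (t j) = inl a & kd (t l) = inl b].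

(* Coordinate 2 is left free: this is the coordinate gained by letting the name
   at coordinate 1 stand for two types. *)
Definition avoids t := exists p a b, [/\ kd (t 0) = inl p, kd (t 1) = inr (a, b),
  p <> a, p <> b & forall j, 2 < j -> kd (t j) <> inl p].

Lemma color_invariant c s t : eqv h s t -> color s c -> color t c.
Proof.
move=> [st cst] sc; have gt := weak_good hP hP (weak_sym st) sc.1.
by have [d td] := color_ex gt; rewrite (cst _ _ sc td : c = d).
Qed.

Lemma good_invariant s t : eqv h s t -> good s -> good t.
Proof. by move=> [/weak_sym st _]; apply: weak_good st. Qed.

Lemma eqv_kd s t : eqv h s t ->
  exists2 r, injective r & forall i, kd (t i) = kact r (kd (s i)).
Proof. by move=> [/weak_sym/weak_kd]. Qed.

Lemma same_type_invariant i j s t : eqv h s t -> same_type i j s -> same_type i j t.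
Proof.
by move=> /eqv_kd[r _ kE] [a [si sj]]; exists (r a); rewrite !kE si sj.
Qed.

Lemma named_invariant i j l s t : eqv h s t -> named i j l s -> named i j l t.
Proof.
move=> /eqv_kd[r _ kE] [a [b [si sj sl]]]; exists (r a), (r b).
by rewrite !kE si sj sl.
Qed.

Lemma avoids_invariant s t : eqv h s t -> avoids s -> avoids t.
Proof.
move=> /eqv_kd[r rI kE] [p [a [b [s0 s1 pa pb sp]]]]; exists (r p), (r a), (r b).
rewrite !kE s0 s1; split=> // [/rI//|/rI//|j j2].
by rewrite kE -[inl (r p)]/(kact r (inl p)) => /(kact_inj rI); apply: sp.
Qed.

Definition Color c : A := elt (@color_invariant c).
Definition Good : A := elt good_invariant.
Definition Same i j : A := elt (@same_type_invariant i j).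
Definition Named i j l : A := elt (@named_invariant i j l).
Definition Avoids : A := elt avoids_invariant.

Definition bigmeet (I : Type) (F : I -> A) (l : seq I) : A :=
  foldr (fun i acc => qa_meet A (F i) acc) (qa_one A) l.

Lemma bigmeetE (I : eqType) (F : I -> A) l t :
  (sval (bigmeet F l)).2 t -> forall i, i \in l -> (sval (F i)).2 t.
Proof.
elim: l => //= i l IH [Fi /IH Fl] j; rewrite inE => /orP[/eqP->//|].
exact: Fl.
Qed.

(** * Properties forced on a hypothetical representation *)

Section Representation.
Variables (K : Type) (U : K -> Type) (f : A -> forall k, sset (U k)).
Arguments f : clear implicits.
Hypotheses (fA : QA_embedding A K U f)
  (fD : forall i j k s, f (qea_diag A i j) k s <-> set_diag i j s).
Variable k : K.
Implicit Types s : nat -> U k.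
Local Notation P x s := (f x k s).

Lemma rep_meet x y s : P (qa_meet A x y) s <-> P x s /\ P y s.
Proof. by case: fA => _ [_ [+ _]]; apply. Qed.

Lemma rep_compl x s : P (qa_compl A x) s <-> ~ P x s.
Proof. by case: fA => _ [_ [_ [+ _]]]; apply. Qed.

Lemma rep_zero s : ~ P (qa_zero A) s.
Proof. by case: fA => _ [_ [_ [_ [+ _]]]] => /(_ k s) ->. Qed.

Lemma rep_one s : P (qa_one A) s.
Proof. by case: fA => _ [_ [_ [_ [_ [+ _]]]]] => /(_ k s) ->. Qed.

Lemma rep_cyl i x s : P (qa_cyl A i x) s <-> exists u, P x (upd s i u).
Proof. by case: fA => _ [_ [_ [_ [_ [_ [+ _]]]]]]; apply. Qed.

Lemma rep_subr i j x s : P (qa_subr A i j x) s <-> P x (upd s i (s j)).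
Proof. by rewrite -sub_repl; case: fA => _ [_ [_ [_ [_ [_ [_ [+ _]]]]]]]; apply. Qed.

Lemma rep_subt i j x s :
  P (qa_subt A i j x) s <-> P x (fun l => s (transp i j l)).
Proof. by case: fA => _ [_ [_ [_ [_ [_ [_ [_ +]]]]]]]; apply. Qed.

(** Inclusion is the equation [qa_meet A x y = x], so whatever inclusion is checked in [A] passes to
    the representation. *)
Lemma rep_le x y s :
  (forall t, (sval x).2 t -> (sval y).2 t) -> P x s -> P y s.
Proof.
move=> xy; have <- : qa_meet A x y = x; last by move=> /rep_meet[].
by apply: pair_alg_ext2 => t /=; split=> [[]|xt] //; split=> //; apply: xy.
Qed.

Lemma rep_repl i j x y s : (forall t, (sval x).2 (upd t i (t j)) -> (sval y).2 t) ->
  P x (upd s i (s j)) -> P y s.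
Proof.
move=> xy /rep_subr; apply: rep_le => t /=.
by rewrite /set_sub sub_repl; apply: xy.
Qed.

Lemma rep_transp i j x y s :
  (forall t, (sval x).2 (fun l => t (transp i j l)) -> (sval y).2 t) ->
  P x (fun l => s (transp i j l)) -> P y s.
Proof. by move=> xy /rep_subt; apply: rep_le. Qed.

(** The premise says that [qa_cyl A i x] lies below [x], an inclusion that the representation
    preserves. *)
Lemma rep_indep i u x s : (forall t v, (sval x).2 (upd t i v) -> (sval x).2 t) ->
  P x s -> P x (upd s i u).
Proof.
move=> xi xs; have : P (qa_cyl A i x) (upd s i u).
  by apply/rep_cyl; exists (s i); rewrite upd_upd upd_same.
by apply: rep_le => t [v]; apply: xi.
Qed.

Lemma rep_bigmeet (I : eqType) (F : I -> A) l s :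
  (forall i, i \in l -> P (F i) s) -> P (bigmeet F l) s.
Proof.
elim: l => [_|i l IH Fl] /=; first exact: rep_one.
apply/rep_meet; split; first by apply: Fl; rewrite inE eqxx.
by apply: IH => j jl; apply: Fl; rewrite inE jl orbT.
Qed.

(** [rep_indep] frees one coordinate at a time, so only finitely many may be changed. *)
Lemma rep_same_finite n s s' : (forall j, n <= j -> s' j = s j) ->
  s' 0 = s 0 -> s' 2 = s 2 -> P (Same 0 2) s -> P (Same 0 2) s'.
Proof.
elim: n s => [|n IH] s ss' e0 e2.
  by rewrite (_ : s = s') //; apply: funext => j; rewrite ss'.
move=> Ss; apply: (IH (upd s n (s' n))) => [j nj|||].
- rewrite updE; case: eqP => [->//|/eqP jn]; apply: ss'.
  by rewrite ltn_neqAle eq_sym jn.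
- by rewrite updE; case: eqP => // <-.
- by rewrite updE; case: eqP => // <-.
have [n0|n0] := eqVneq n 0; first by rewrite n0 e0 upd_same.
have [n2|n2] := eqVneq n 2; first by rewrite n2 e2 upd_same.
apply: rep_indep Ss => t v /=.
by rewrite /same_type !updE eq_sym (negPf n0) eq_sym (negPf n2).
Qed.

Lemma rep_named_indep3 u s : P (Named 0 1 2) s -> P (Named 0 1 2) (upd s 3 u).
Proof. exact: rep_indep. Qed.

(** If [z] also named the type of [s 0] in first place, [s 0] and [s 1] would share a type, against
    goodness. *)
Lemma rep_avoids s z : P Good s -> P (Named 0 1 2) (upd s 0 z) ->
  P Avoids (upd s 1 z).
Proof.
move=> gs Nz.
have N1 : P (qa_cyl A 0 (Named 1 0 2)) (upd s 1 z).
  apply/rep_cyl; exists (s 1); apply: (@rep_transp 0 1 (Named 0 1 2)) => //.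
  by rewrite (_ : (fun _ => _) = upd s 0 z) //; apply: funext => -[|[|[|j]]].
have N2 : ~ P (Named 1 0 2) (upd s 1 z).
  move=> Nu; have {}Nu : P (Named 0 1 2) (upd (upd s 0 z) 1 (s 0)).
    apply: (@rep_transp 0 1 (Named 1 0 2)) => //.
    by rewrite (_ : (fun _ => _) = upd s 1 z) //; apply: funext => -[|[|[|j]]].
  (* Coordinate 3 is scratch space: with [s 0] there and [s 1] at 1, [z] names the types of both in
     first place. *)
  pose q := upd (upd s 0 z) 3 (s 0).
  have q1 : P (Named 0 1 2) q by apply: rep_named_indep3.
  have q3 : P (Named 0 3 2) q.
    apply: (@rep_repl 1 3 (Named 0 1 2)) => //.
    rewrite (_ : upd q _ _ = upd (upd (upd s 0 z) 1 (s 0)) 3 (s 0)).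
      exact: rep_named_indep3.
    by apply: funext => -[|[|[|[|j]]]].
  have : P (qa_meet A (Named 0 1 2) (Named 0 3 2)) q by apply/rep_meet.
  have /[apply] : forall s', P (qa_meet A (Named 0 1 2) (Named 0 3 2)) s' ->
      P (qa_subr A 0 3 (Same 0 1)) s'.
    move=> s'; apply: rep_le => t /= [[a [b [ta tb tc]]] [a' [b' []]]].
    rewrite ta => -[<- <-] td _; exists a.
    by rewrite /repl /=; split.
  move=> /rep_subr Sq; have : P (Same 0 1) (upd (upd q 0 (q 3)) 3 (s 3)).
    exact: rep_indep Sq.
  rewrite (_ : upd _ _ _ = s); last by apply: funext => -[|[|[|[|j]]]].
  apply/rep_compl; apply: rep_le gs => t /= [_ _ tI] [a [t0 t1]].
  by have /tI : kd (t 0) = kd (t 1) by rewrite t0 t1.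
(* These facts imply [Avoids] inside [A]: goodness excludes the types at 2 and beyond, and [N2] the
   first named type. *)
have : P (qa_meet A (qa_cyl A 1 Good)
    (qa_meet A (qa_cyl A 0 (Named 1 0 2)) (qa_compl A (Named 1 0 2)))) (upd s 1 z).
  apply/rep_meet; split; last by apply/rep_meet; split=> //; apply/rep_compl.
  by apply/rep_cyl; exists (s 1); rewrite upd_upd upd_same.
apply: rep_le => t /= [[y gy] [[y' [a [b [t1 _ t2]]]] nN]].
rewrite /upd /= in t1 t2; have [_ ty tI] := gy.
have [p t0] : exists p, kd (t 0) = inl p by apply: (ty 0).
have neq j : 1 < j -> kd (t j) <> inl p.
  move=> j1 tj; have /tI/= j0 : kd (upd t 1 y j) = kd (upd t 1 y 0).
    by rewrite !updE /= gtn_eqF // tj.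
  by rewrite j0 in j1.
exists p, a, b; split=> //.
- by move=> pa; apply: nN; exists p, b; split; rewrite // t1 pa.
- by move=> pb; apply: (neq 2); rewrite // t2 pb.
- by move=> j j2; apply: neq; apply: ltnW.
Qed.

(** The name [z] stands for the types of [s 1] and [s 2], which frees coordinate 2 for [v]. Good
    sequences use every type, so a single type is left for both completions. *)
Lemma rep_same s u v z :
  P Good (upd s 0 u) -> P Good (upd s 0 v) -> P (Named 0 1 2) (upd s 0 z) ->
  P (Same 0 2) (upd (upd (upd s 0 u) 1 z) 2 v).
Proof.
move=> gu gv Nz; set q := upd _ 2 v.
have av w : P Good (upd s 0 w) -> P Avoids (upd (upd (upd s 0 w) 1 z) 2 v).
  move=> gw; apply: rep_indep; last by apply: rep_avoids; rewrite ?upd_upd.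
  move=> t w' [p [a [b [t0 t1 pa pb tp]]]]; exists p, a, b; split=> // j j2.
  by have := tp j j2; rewrite updE gtn_eqF.
(* [R]: coordinate 0 names two types that, with one more entry and the later ones, make a good
   sequence. [qa_subr A 0 1] reads the name from coordinate 1. *)
pose R := qa_cyl A 1 (qa_cyl A 2 (qa_meet A (Named 0 1 2) (qa_cyl A 0 Good))).
have : P (qa_meet A (qa_subr A 0 1 R) (qa_meet A Avoids (qa_subr A 0 2 Avoids))) q.
  apply/rep_meet; split; last first.
    apply/rep_meet; split; first exact: av.
    apply/rep_subr; rewrite (_ : upd _ _ _ = upd (upd (upd s 0 v) 1 z) 2 v).
      exact: av.
    by apply: funext => -[|[|[|j]]].
  apply/rep_subr/rep_cyl; exists (s 1); apply/rep_cyl; exists (s 2).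
  rewrite (_ : upd _ _ _ = upd s 0 z); last by apply: funext => -[|[|[|j]]].
  by apply/rep_meet; split=> //; apply/rep_cyl; exists u; rewrite upd_upd.
apply: rep_le => t /= [[y1 [y2 [[a [b [t1 ky1 ky2]]] [y0 gy]]]]].
rewrite /set_sub /upd /repl /= in t1 ky1 ky2.
move=> [[p [a' [b' [t0 t1' pa pb tp]]]] [q' [a2 [b2]]]].
rewrite /repl /= => -[t2 t1'' qa qb tq].
move: t1' t1''; rewrite t1 => -[aa bb] [aa2 bb2].
subst a' b' a2 b2.
(* By [good_surj] a type neither named nor used beyond coordinate 2 must sit at coordinate 0. *)
have slot e : e <> a -> e <> b -> (forall j, 2 < j -> kd (t j) <> inl e) -> kd y0 = inl e.
  move=> ea eb te; have [[|[|[|j]]] //= ji] := good_surj e gy.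
  - by case: ea; move: ji; rewrite /upd /= ky1 => -[].
  - by case: eb; move: ji; rewrite /upd /= ky2 => -[].
  - by case: (te j.+3).
have py := slot p pa pb tp.
have : kd y0 = inl q'.
  apply: slot => // j j2; have := tq j j2.
  by rewrite nat_eqbE gtn_eqF //; apply: ltn_trans j2.
by rewrite py => -[pq]; exists p; rewrite t0 t2 pq.
Qed.

Lemma rep_Color_Good c s : P (Color c) s -> P Good s.
Proof. by apply: rep_le => t []. Qed.

Lemma rep_Color_void c s : ~ P (Color c) s.
Proof.
move=> sc.
have /choice[u uP] d : exists u, P (Color d) (upd s 0 u).
  apply/rep_cyl; move: sc; apply: rep_le => t [gt _].
  have gt' : good (upd t 0 (t 0)) by rewrite upd_same.
  by have [u' _ tc] := color_upd d gt'; exists u'.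
have uI : injective u.
  move=> d d' ud; apply: contrapT => dd'; apply: (@rep_zero (upd s 0 (u d))).
  have : P (qa_meet A (Color d) (Color d')) (upd s 0 (u d)).
    by apply/rep_meet; split=> //; rewrite ud.
  by apply: rep_le => t [/color_uniq td /td].
have [z Nz] : exists z, P (Named 0 1 2) (upd s 0 z).
  apply/rep_cyl; move: (rep_Color_Good sc); apply: rep_le => t [_ ty _].
  have [a ta] := ty 1; have [b tb] := ty 2.
  by exists (inr (a, b)), a, b.
(* The [m + 1] completions are stored at coordinates 3 to [m + 3], clear of 0, 1 and 2, by finitely
   many changes. *)
pose w j := if 2 < j < m + 4 then u (inord (j - 3)) else s j.
have wE (d : 'I_m.+1) : w (3 + d) = u d.
  by rewrite /w addKn inord_val leq_addr (addnC m) (addSnnS 3) ltn_add2l ltn_ord.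
have Sw (d d' : 'I_m.+1) : P (Same (3 + d) (3 + d')) w.
  apply: (@rep_repl 0 (3 + d) (Same 0 (3 + d'))).
    by move=> t; rewrite /= /same_type !updE.
  apply: (@rep_repl 2 (3 + d') (Same 0 2)).
    by move=> t; rewrite /= /same_type !updE.
  have := rep_same (rep_Color_Good (uP d)) (rep_Color_Good (uP d')) Nz.
  apply: (@rep_same_finite (m + 4)); rewrite ?updE ?wE //.
  move=> j; rewrite addnC; case: j => [|[|[|j]]] // mj.
  by rewrite !updE /= /w (addnC m) [_ < 4 + m]ltnNge mj andbF.
(* Same type, yet off the diagonal. In [A] the diagonals see only values in [H], so the finite meet
   over all pairs is empty by pigeonhole. *)
pose F (p : 'I_m.+1 * 'I_m.+1) : A := qa_meet A (Same (3 + p.1) (3 + p.2))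
  (qa_compl A (qea_diag A (3 + p.1) (3 + p.2))).
pose l := [seq p <- enum {: 'I_m.+1 * 'I_m.+1} | p.1 != p.2].
have : P (bigmeet F l) w.
  apply: rep_bigmeet => -[d d']; rewrite mem_filter /= => /andP[dd' _].
  apply/rep_meet; split; first exact: Sw.
  by apply/rep_compl => /fD; rewrite /set_diag !wE => /uI /eqP; rewrite (negPf dd').
move=> Fw; apply: (@rep_zero w); move: Fw; apply: rep_le => t /bigmeetE tF /=.
suff : m.+1 <= #|H| by rewrite leqNgt mH.
pose v (d : 'I_m.+1) := weight (collapse h (t (3 + d))).
have vI : injective v.
  move=> d d' vd; apply: contrapT => /eqP dd'.
  have /= [[a []]] : (sval (F (d, d'))).2 t.
    by apply: tF; rewrite mem_filter /= dd' mem_enum.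
  rewrite /v in vd; move: vd.
  case: (t _) => [[b x]|//] /=; case: (t _) => [[b' x']|//] /= -> [->] [->].
  by move=> [].
by have := leq_card v vI; rewrite card_ord.
Qed.

End Representation.

Lemma inv_alg_not_RQEA : ~ RQEA A.
Proof.
move=> [K [U [f [fA fD]]]].
have [c0 tc0] := color_ex (good_base 'I_m.+1).
(* The base sequence lies in [Color c0], whose image in the representation is nevertheless empty. *)
suff E : Color c0 = qa_zero A.
  have := congr1 (fun x : A => (sval x).2 (base_seq 'I_m.+1)) E.
  by move=> /= E'; rewrite E' in tc0.
case: (fA) => + _; apply=> k s; split.
- by move=> /(rep_Color_void fA fD).
- by move=> /(rep_zero fA).
Qed.

End NonRepresentable.

(** * The two cyclic groups and the conclusion *)

Definition fold_top k (x : 'I_k.+3) : 'I_k.+2 := inord (if x < k.+2 then val x else 1).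

(** The surplus top element goes to 1, so 0 keeps a single preimage. *)
Lemma fold_top_faithful k : faithful_at0 (@fold_top k).
Proof.
split=> [x|y]; last first.
  by exists (widen_ord (leqnSn _) y); apply: val_inj; rewrite /fold_top /= ltn_ord inord_val.
split=> [/(congr1 val)|->]; last by apply: val_inj; rewrite /= inordK.
rewrite /= inordK; last by case: ifP.
by case: ifP => // _ x0; apply: val_inj.
Qed.

Theorem mainTheorem2 :
  ~ exists Sigma : formula -> Prop,
      (forall phi, Sigma phi -> universal phi) /\
      (exists n : nat, forall phi, Sigma phi -> vars_lt n phi) /\
      (forall A : QEA_alg, RQEA A -> models_set A Sigma) /\
      (forall A : QEA_alg, models_set A Sigma -> RQA (qea_rd A) -> RQEA A).
Proof.
move=> [Sigma [univ [[n vars] [valid axiom]]]].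
(* The orders are [2 ^ n + 2] for [H] and [2 ^ n + 3] for [G]: enough labels for [n] variables, yet
   [H] is smaller than [G]. *)
pose hP := fold_top_faithful (2 ^ n).
apply: (@inv_alg_not_RQEA _ _ _ hP); first by rewrite card_ord.
apply: axiom; last exact: pair_alg_RQA.
move=> phi phiS; apply: (@inv_alg_models _ _ _ hP n).
- by rewrite card_ord ltnW // ltnW.
- exact: univ.
- exact: vars.
- by move=> A /valid; apply.
Qed.
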